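(* Let $A$ be a finite set and let $\rho\subseteq A^n$, $n\ge 3$, be an essential key relation preserved by a weak near-unanimity function. Then the pattern $\overset{\rho}{\sim}$ of $\rho$ is an equivalence relation on $\{1,\dots,n\}$, and at most one of its equivalence classes contains more than one element.
   Context: A unary vector-function is a tuple $\Psi=(\psi_1,\dots,\psi_n)$ of maps $\psi_i:A\to A$ acting coordinatewise; it preserves $\rho$ if $\Psi(\rho)\subseteq\rho$. $\rho\subseteq A^n$ is a key relation if there is $\beta\in A^n\setminus\rho$ (a key tuple) such that every $\alpha\in A^n\setminus\rho$ is mapped to $\beta$ by some unary vector-function preserving $\rho$. $\rho$ is essential if it cannot be written as a conjunction of relations of smaller arities (equivalently, there is a tuple $\alpha\notin\rho$ such that for each coordinate $i$, changing the $i$-th coordinate of $\alpha$ suitably yields a tuple in $\rho$). A weak near-unanimity function (WNU) is an $m$-ary ($m\ge2$) operation $f$ on $A$ with $f(x,\dots,x)=x$ and $f(y,x,\dots,x)=f(x,y,x,\dots,x)=\dots=f(x,\dots,x,y)$; $f$ preserves $\rho$ if applying $f$ coordinatewise to any $m$ tuples of $\rho$ yields a tuple of $\rho$. The pattern of $\rho$: for $i\ne j$, $i\overset{\rho}{\sim}j$ iff there do NOT exist $a_1,\dots,a_n,b_i,b_j\in A$ such that $(a_1,\dots,a_n)\notin\rho$ while the tuples obtained from $(a_1,\dots,a_n)$ by replacing $a_i$ with $b_i$, by replacing $a_j$ with $b_j$, and by replacing both, all lie in $\rho$; also $i\overset{\rho}{\sim}i$ for all $i$. *)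

(* Defs.v *)
From mathcomp Require Import all_boot.
Set Implicit Arguments. Unset Strict Implicit. Unset Printing Implicit Defensive.

Notation tup A n := {ffun 'I_n -> A}.
Notation relA A n := {set {ffun 'I_n -> A}}.

Definition upd (A : finType) n (a : tup A n) (i : 'I_n) (b : A) : tup A n :=
  [ffun j => if j == i then b else a j].

Definition vapply (A : finType) n (Psi : 'I_n -> A -> A) (a : tup A n) : tup A n :=
  [ffun i => Psi i (a i)].

Definition vpreserves (A : finType) n (Psi : 'I_n -> A -> A) (rho : relA A n) :=
  forall a, a \in rho -> vapply Psi a \in rho.

Definition key_tuple (A : finType) n (rho : relA A n) (beta : tup A n) :=
  beta \notin rho /\
  forall alpha, alpha \notin rho ->
    exists Psi : 'I_n -> A -> A, vpreserves Psi rho /\ vapply Psi alpha = beta.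

Definition key_relation (A : finType) n (rho : relA A n) :=
  exists beta, key_tuple rho beta.

(* sigma (viewed as an n-ary relation) does not depend on coordinate i,
   i.e. it is (up to adding a dummy variable) a relation of smaller arity. *)
Definition ignores_coord (A : finType) n (sigma : relA A n) (i : 'I_n) :=
  forall a b, a \in sigma -> upd a i b \in sigma.

(* rho is a conjunction of relations of arities smaller than n (with
   arbitrary choice/identification of variables among x_1..x_n). *)
Definition conj_smaller (A : finType) n (rho : relA A n) :=
  exists S : {set relA A n},
    (forall sigma, sigma \in S -> exists i, ignores_coord sigma i) /\
    (forall a, a \in rho <-> (forall sigma, sigma \in S -> a \in sigma)).

Definition essential (A : finType) n (rho : relA A n) := ~ conj_smaller rho.

Definition const_tup (A : finType) m (x : A) : tup A m := [ffun _ => x].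

Definition is_WNU (A : finType) m (f : tup A m -> A) :=
  (2 <= m)%N /\
  (forall x, f (const_tup m x) = x) /\
  (forall x y (i j : 'I_m),
      f (upd (const_tup m x) i y) = f (upd (const_tup m x) j y)).

Definition op_preserves (A : finType) m n (f : tup A m -> A) (rho : relA A n) :=
  forall t : 'I_m -> tup A n, (forall l, t l \in rho) ->
    [ffun k => f [ffun l => t l k]] \in rho.

Definition pattern (A : finType) n (rho : relA A n) (i j : 'I_n) : Prop :=
  i = j \/
  ~ (exists (a : tup A n) (bi bj : A),
        a \notin rho /\ upd a i bi \in rho /\ upd a j bj \in rho /\
        upd (upd a i bi) j bj \in rho).

(* Main.v *)
Require Import Defs.
From mathcomp Require Import all_boot fingroup perm.

(** Let [beta] be a key tuple and let [i1 ~ i2].  With all other coordinates frozen at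
    [beta], [rho] is a rectangular relation between coordinates [i1] and [i2], so its
    edges fall into classes on which every polymorphism acts.  Let [e] and [u] be edges
    differing from [beta] only at [i2] (value [b2]), resp. only at [i1] (value [b1]);
    their classes are distinct because [beta] is not in [rho].  The key property sends
    any two distinct classes to those of [e] and [u]; in particular it yields a negation.
    Combined with the WNU this produces a binary polymorphism [p] which looks like
    exclusive or on the classes of [e] and [u], except that [p(u,u)] may be any class
    other than that of [u].

    A vector-function preserving [rho] and fixing [beta] whose image [M] is smallest
    plays the role of a core: a vector-function preserving [rho] that does not send
    [beta] into [rho] is injective on [M], hence invertible there.  So [p] can be
    normalised on [M] to [p(x,e) = p(e,x) = x], and then [p(-,u)] is invertible.  Write
    tuples as lists of the relevant coordinates, [0] being the value of [beta].

    If [i1 ~ i2 ~ i3] but not [i1 ~ i3], witnessed by [(b1,0,b3)], then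
    [p((0,0,b3),(b1,0,b3))] is the image under [p(-,u)] of [(0,0,p(b3,b3))], which is
    therefore in [rho]; rectangularity in [i2], [i3] then makes the set of [y] with
    [(0,y,b3)] in [rho] stable under [p(-,0)].  This injection maps [b2] to [0], which
    lies in the set, so [b2] does too, which contradicts [i2 ~ i3].

    If [i1 ~ i2], [i3 ~ i4] but not [i1 ~ i4], witnessed by [(b1,0,0,b4)], then
    [p((0,0,b3,0),(b1,0,0,b4))] is the image under [p(-,u)] of [(0,0,b3,b4)], which
    is therefore in [rho], contradicting [i3 ~ i4]. *)

Set Implicit Arguments. Unset Strict Implicit. Unset Printing Implicit Defensive.

(** * Vector-functions and coordinate updates *)

Definition bapply (A : finType) n (p : 'I_n -> A -> A -> A) (a b : tup A n) :
  tup A n := [ffun i => p i (a i) (b i)].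

Definition bpreserves (A : finType) n (p : 'I_n -> A -> A -> A) (rho : relA A n) :=
  forall a b, a \in rho -> b \in rho -> bapply p a b \in rho.

Lemma vapply_upd (A : finType) n (Psi : 'I_n -> A -> A) (a : tup A n) i b :
  vapply Psi (upd a i b) = upd (vapply Psi a) i (Psi i b).
Proof. by apply/ffunP=> j; rewrite !ffunE; case: eqP => [->|]. Qed.

Lemma upd_id (A : finType) n (a : tup A n) i : upd a i (a i) = a.
Proof. by apply/ffunP=> j; rewrite ffunE; case: eqP => [->|]. Qed.

Lemma upd_upd (A : finType) n (a : tup A n) i b c : upd (upd a i b) i c = upd a i c.
Proof. by apply/ffunP=> j; rewrite !ffunE; case: eqP. Qed.

Lemma updC (A : finType) n (a : tup A n) i j b c :
  i != j -> upd (upd a i b) j c = upd (upd a j c) i b.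
Proof.
move=> nij; apply/ffunP=> k; rewrite !ffunE.
by case: (k =P j) => // ->; rewrite eq_sym (negbTE nij).
Qed.

Lemma vpreserves_comp (A : finType) n (Psi Phi : 'I_n -> A -> A) (rho : relA A n) :
  vpreserves Psi rho -> vpreserves Phi rho ->
  vpreserves (fun i x => Psi i (Phi i x)) rho.
Proof.
move=> hPsi hPhi a /hPhi/hPsi; congr (_ \in rho).
by apply/ffunP=> i; rewrite !ffunE.
Qed.

Lemma vpreserves_iter (A : finType) n (Psi : 'I_n -> A -> A) (rho : relA A n) k :
  vpreserves Psi rho -> vpreserves (fun i => iter k (Psi i)) rho.
Proof.
move=> hPsi; elim: k => [|k IHk] a ha.
  by rewrite (_ : vapply _ a = a) //; apply/ffunP=> i; rewrite ffunE.
exact: (vpreserves_comp hPsi IHk).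
Qed.

(** * Key tuples and the core *)

Section Core.
Variables (A : finType) (n : nat) (rho : relA A n) (beta : tup A n).
Hypothesis hkey : key_tuple rho beta.

Lemma key_tuple_notin : beta \notin rho. Proof. by case: hkey. Qed.

(** Otherwise [rho] ignores [i]: if an update at [i] of some [a] in [rho] left [rho], the
    vector-function sending it to [beta] would send [a] to an update of [beta] at [i], inside
    [rho]. *)
Lemma essential_key_tuple i : essential rho -> exists b, upd beta i b \in rho.
Proof.
move=> hess; case: (boolP [exists b, upd beta i b \in rho]) => [/existsP //|nex].
case: hess; exists [set rho]; split=> [sigma|a]; last first.
  by split=> [ha sigma /set1P-> //|]; apply; rewrite inE.
move/set1P->; exists i => a b ha.
apply: contraR nex => /hkey.2 [Psi [hPsi <-]]; apply/existsP.
by exists (Psi i (a i)); rewrite -vapply_upd upd_upd upd_id; apply: hPsi.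
Qed.

Lemma not_pattern_key_tuple i j : ~ pattern rho i j ->
  exists bi bj, [/\ upd beta i bi \in rho, upd beta j bj \in rho
                  & upd (upd beta i bi) j bj \in rho].
Proof.
move=> npat.
case: (boolP [exists bi, exists bj, [&& upd beta i bi \in rho, upd beta j bj \in rho
                  & upd (upd beta i bi) j bj \in rho]]).
  by move=> /existsP [bi /existsP [bj /and3P hb]]; exists bi, bj.
move=> nex; case: npat; right=> -[a [bi [bj [na [hi [hj hij]]]]]].
have [Psi [hPsi eb]] := hkey.2 _ na.
case/negP: nex; rewrite -eb; apply/existsP; exists (Psi i bi); apply/existsP; exists (Psi j bj).
by rewrite -!vapply_upd; apply/and3P; split; apply: hPsi.
Qed.

(** Choose [E] with smallest image. If [Psi] keeps [beta] outside [rho], some [Phi] brings it back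
    to [beta]; then [E Phi Psi E] competes with [E], so [Psi] cannot merge values in the image of
    [E]. *)
Lemma core_exists : exists (E : 'I_n -> A -> A) (M : 'I_n -> {set A}),
  [/\ vpreserves E rho, vapply E beta = beta, (forall i x, E i x \in M i)
    & forall Psi, vpreserves Psi rho -> vapply Psi beta \notin rho ->
        forall i, {in M i &, injective (Psi i)}].
Proof.
pose V := {ffun 'I_n -> {ffun A -> A}}.
pose fn (v : V) i x := v i x.
(* Tagging values by their coordinate lets one cardinality measure all coordinates together. *)
pose im (v : V) := [set (q.1, v q.1 q.2) | q in [set: 'I_n * A]].
pose P (v : V) := [forall a in rho, vapply (fn v) a \in rho] && (vapply (fn v) beta == beta).
have P1 : P [ffun=> [ffun x => x]].
  have vid a : vapply (fn [ffun=> [ffun x => x]]) a = a.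
    by apply/ffunP=> i; rewrite /fn !ffunE.
  by apply/andP; split; [apply/forall_inP=> a; rewrite vid | rewrite vid].
case: (arg_minnP (fun v => #|im v|) P1) => e /andP[/forall_inP ePres /eqP eb] emin.
exists (fn e), (fun i => [set e i x | x in A]); split=> // [i x|]; first by rewrite /fn imset_f.
move=> Psi hPsi /hkey.2 [Phi [hPhi hb]] i.
pose g i x := e i (Phi i (Psi i x)).
have gPres : vpreserves (fun i x => g i (e i x)) rho.
  exact: (vpreserves_comp (vpreserves_comp (vpreserves_comp ePres hPhi) hPsi) ePres).
pose v : V := [ffun i => [ffun x => g i (e i x)]].
have vE a : vapply (fn v) a = vapply (fun i x => g i (e i x)) a.
  by apply/ffunP=> j; rewrite /fn !ffunE.
have Pv : P v.
  apply/andP; split; first by apply/forall_inP=> a ha; rewrite vE gPres.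
  rewrite vE; apply/eqP/ffunP=> j; rewrite -{2}eb -{2}hb.
  by move/ffunP/(_ j): eb; rewrite /fn /g !ffunE => ->.
have imv : im v = (fun q => (q.1, g q.1 q.2)) @: im e.
  by rewrite /im -imset_comp; apply: eq_imset => q; rewrite /= !ffunE.
have /imset_injP ginj : #|(fun q => (q.1, g q.1 q.2)) @: im e| == #|im e|.
  by rewrite eqn_leq leq_imset_card -imv emin.
move=> _ _ /imsetP[x _ ->] /imsetP[y _ ->] exy.
have im_e z : (i, e i z) \in im e by apply/imsetP; exists (i, z).
by have := ginj _ _ (im_e x) (im_e y); rewrite /= /g exy => /(_ erefl) [].
Qed.

Variables (E : 'I_n -> A -> A) (M : 'I_n -> {set A}).
Hypothesis hE : vpreserves E rho.
Hypothesis hEb : vapply E beta = beta.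
Hypothesis hEM : forall i x, E i x \in M i.
Hypothesis core_inj : forall Psi, vpreserves Psi rho -> vapply Psi beta \notin rho ->
        forall i, {in M i &, injective (Psi i)}.

Lemma E_beta i : E i (beta i) = beta i.
Proof. by rewrite -{2}hEb ffunE. Qed.

Lemma beta_core i : beta i \in M i.
Proof. by rewrite -E_beta. Qed.

Lemma core_inverse Psi : vpreserves Psi rho -> vapply Psi beta \notin rho ->
  (forall i x, x \in M i -> Psi i x \in M i) ->
  exists Phi, [/\ vpreserves Phi rho, (forall i x, x \in M i -> Phi i x \in M i),
    (forall i x, x \in M i -> Phi i (Psi i x) = x)
    & (forall i x, x \in M i -> Psi i (Phi i x) = x)].
Proof.
move=> hPsi nb PsiM.
(* [Psi] on [M], extended by the identity, permutes a finite set; its inverse is a power, so it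
   preserves [rho]. *)
pose G (q : 'I_n * A) := if q.2 \in M q.1 then (q.1, Psi q.1 q.2) else q.
have Ginj : injective G.
  move=> [i x] [j y]; rewrite /G /=.
  case: ifP => hx; case: ifP => hy; case.
  - by move=> eij; subst j => /(core_inj hPsi nb) ->.
  - by move=> eij; subst j => exy; rewrite -exy PsiM in hy.
  - by move=> eij; subst j => exy; rewrite exy PsiM in hx.
  - by move=> -> ->.
have iterM k i x : x \in M i -> iter k (Psi i) x \in M i.
  by move=> hx; elim: k => //= k; apply: PsiM.
have iterG k i x : x \in M i -> iter k G (i, x) = (i, iter k (Psi i) x).
  by move=> hx; elim: k => //= k ->; rewrite /G /= iterM.
have [k hk] : exists k, forall q, iter k.+1 G q = q.
  exists #[perm Ginj]%g.-1 => q; rewrite prednK ?order_gt0 //.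
  rewrite -[RHS](perm1 q) -(expg_order (perm Ginj)) permX.
  by apply: eq_iter => r; rewrite permE.
exists (fun j => iter k (Psi j)); split=> [||i x hx|i x hx].
- exact: vpreserves_iter.
- exact: iterM.
- by have := hk (i, x); rewrite iterG // iterSr => -[].
- by have := hk (i, x); rewrite iterG // iterS => -[].
Qed.

(* The last two clauses express that [p(-, u)], with [u := upd beta i1 b1], is
   invertible on [M]. *)
Definition shift_op (p : 'I_n -> A -> A -> A) (i1 i2 : 'I_n) (b1 b2 : A) :=
  [/\ bpreserves p rho,
      forall i x y, x \in M i -> y \in M i -> p i x y \in M i,
      forall i x, x \in M i ->
        p i x (upd beta i2 b2 i) = x /\ p i (upd beta i2 b2 i) x = x,
      forall a : tup A n, (forall i, a i \in M i) ->
        bapply p a (upd beta i1 b1) \in rho -> a \in rho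
    & {in M i2 &, injective (fun y => p i2 y (beta i2))}].

(** * Classes of edges in a rectangular slice *)

Section Rectangle.
Variables (i1 i2 : 'I_n) (b1 b2 : A).
Hypothesis n12 : i1 != i2.

Definition pt x y : tup A n :=
  [ffun i => if i == i1 then x else if i == i2 then y else beta i].

Definition R0 x y := pt x y \in rho.

Hypothesis R0_rect : forall x x' y y', R0 x y' -> R0 x' y -> R0 x' y' -> R0 x y.
Hypothesis b1M : b1 \in M i1.
Hypothesis b2M : b2 \in M i2.
Hypothesis R0b1 : R0 b1 (beta i2).
Hypothesis R0b2 : R0 (beta i1) b2.

Definition fix_off (Psi : 'I_n -> A -> A) :=
  forall i, i != i1 -> i != i2 -> Psi i (beta i) = beta i.

(* Unary and binary polymorphisms of [rho] into the core that act on the slice [R0]. *)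
Definition vop Psi :=
  [/\ vpreserves Psi rho, fix_off Psi & forall i x, Psi i x \in M i].

Definition bop (p : 'I_n -> A -> A -> A) :=
  [/\ bpreserves p rho, fix_off (fun i x => p i x x) & forall i x y, p i x y \in M i].

Lemma pt_beta : pt (beta i1) (beta i2) = beta.
Proof. by apply/ffunP=> i; rewrite ffunE; case: eqP => [->|_] //; case: eqP => [->|]. Qed.

Lemma R0_beta : ~~ R0 (beta i1) (beta i2).
Proof. by rewrite /R0 pt_beta key_tuple_notin. Qed.

Lemma vapply_pt Psi x y : fix_off Psi -> vapply Psi (pt x y) = pt (Psi i1 x) (Psi i2 y).
Proof.
move=> hoff; apply/ffunP=> i; rewrite !ffunE; case: (i =P i1) => [->|/eqP n1] //.
by case: (i =P i2) => [->|/eqP n2] //; rewrite hoff.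
Qed.

Lemma bapply_pt p x y x' y' : fix_off (fun i z => p i z z) ->
  bapply p (pt x y) (pt x' y') = pt (p i1 x x') (p i2 y y').
Proof.
move=> hoff; apply/ffunP=> i; rewrite !ffunE; case: (i =P i1) => [->|/eqP n1] //.
by case: (i =P i2) => [->|/eqP n2] //; rewrite hoff.
Qed.

Lemma R0_vapply Psi x y : vpreserves Psi rho -> fix_off Psi ->
  R0 x y -> R0 (Psi i1 x) (Psi i2 y).
Proof. by move=> hPsi hoff /hPsi; rewrite vapply_pt. Qed.

Lemma R0_bapply p x y x' y' : bop p -> R0 x y -> R0 x' y' -> R0 (p i1 x x') (p i2 y y').
Proof. by move=> [hp hoff _] h h'; have := hp _ _ h h'; rewrite bapply_pt. Qed.

Definition cx (c : bool) := if c then b1 else beta i1.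
Definition cy (c : bool) := if c then beta i2 else b2.

(* The edge [(x, y)] of [R0] is in the class of [(cx c, cy c)], which is that of [u] for
   [c = true] and that of [e] for [c = false]. *)
Definition V c x y := [/\ R0 x y, R0 x (cy c) & R0 (cx c) y].

Lemma V_can c : V c (cx c) (cy c).
Proof. by case: c; split. Qed.

Lemma V_false_true x y x' y' : V false x y -> V true x' y' -> ~~ R0 x y'.
Proof.
move=> [_ h1 _] [_ _ h2]; apply: contra R0_beta => h.
exact: R0_rect (R0_rect R0b2 h h1) R0b1 h2.
Qed.

Definition computes p (g : bool -> bool -> bool) :=
  forall c c' x y x' y', V c x y -> V c' x' y' -> V (g c c') (p i1 x x') (p i2 y y').

(** Rectangularity carries a truth table from the representative edges to their whole classes. *)
Lemma computes_can (g : bool -> bool -> bool) p : bop p ->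
  (forall c c', V (g c c') (p i1 (cx c) (cx c')) (p i2 (cy c) (cy c'))) -> computes p g.
Proof.
move=> hp hg c c' x y x' y' [h1 h2 h3] [k1 k2 k3]; have [m1 m2 m3] := hg c c'.
split; first exact: R0_bapply.
  exact: R0_rect (R0_bapply hp h2 k2) m2 m1.
exact: R0_rect m3 (R0_bapply hp h3 k3) m1.
Qed.

Lemma V_vapply Psi c d : vop Psi -> V d (Psi i1 (cx c)) (Psi i2 (cy c)) ->
  forall x y, V c x y -> V d (Psi i1 x) (Psi i2 y).
Proof.
move=> [hp hoff _] [m1 m2 m3] x y [h1 h2 h3].
split; first exact: R0_vapply.
  exact: R0_rect (R0_vapply hp hoff h2) m2 m1.
exact: R0_rect m3 (R0_vapply hp hoff h3) m1.
Qed.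

(** The key property sends the missing edge [pt x y'] to [beta], so the images of the two given
    edges share an endpoint with [e] and with [u] respectively. *)
Lemma separate x y x' y' : R0 x y -> R0 x' y' -> ~~ R0 x y' ->
  exists2 Psi, vop Psi & V false (Psi i1 x) (Psi i2 y) /\ V true (Psi i1 x') (Psi i2 y').
Proof.
move=> h h' /hkey.2 [Psi [hPsi /ffunP hb]].
have hp := vpreserves_comp hE hPsi.
have hoff : fix_off (fun i z => E i (Psi i z)).
  move=> i n1 n2; have := hb i.
  by rewrite !ffunE (negbTE n1) (negbTE n2) => ->; rewrite E_beta.
exists (fun i z => E i (Psi i z)); first by split.
have e1 : E i1 (Psi i1 x) = beta i1 by have := hb i1; rewrite !ffunE eqxx => ->; rewrite E_beta.
have e2 : E i2 (Psi i2 y') = beta i2.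
  by have := hb i2; rewrite !ffunE eqxx eq_sym (negbTE n12) => ->; rewrite E_beta.
have /= k := R0_vapply hp hoff h; have /= k' := R0_vapply hp hoff h'.
by rewrite e1 in k *; rewrite e2 in k' *; split; split.
Qed.

(** Separating [u] from [e], in this order, swaps their classes. *)
Lemma negation_exists :
  exists2 N, vop N & forall c x y, V c x y -> V (~~ c) (N i1 x) (N i2 y).
Proof.
have n12' : ~~ R0 b1 b2 by apply: contra R0_beta; apply: R0_rect.
have [N hN [h1 h2]] := separate R0b1 R0b2 n12'.
by exists N => // -[] x y; apply: V_vapply.
Qed.

Lemma bop_comp p q r : bop p -> bop q -> bop r ->
  bop (fun i x y => p i (q i x y) (r i x y)).
Proof.
move=> [hp fp Mp] [hq fq Mq] [hr fr Mr]; split=> [a b ha hb|i n1 n2|//].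
  have := hp _ _ (hq _ _ ha hb) (hr _ _ ha hb); congr (_ \in rho).
  by apply/ffunP=> i; rewrite !ffunE.
by rewrite /= fq // fr // fp.
Qed.

Lemma bop_vcomp N p : vop N -> bop p -> bop (fun i x y => N i (p i x y)).
Proof.
move=> [hN fN MN] [hp fp Mp]; split=> [a b ha hb|i n1 n2|//].
  have := hN _ (hp _ _ ha hb); congr (_ \in rho).
  by apply/ffunP=> i; rewrite !ffunE.
by rewrite /= fp // fN.
Qed.

Lemma bop_compv N p : vop N -> bop p -> bop (fun i x y => p i (N i x) (N i y)).
Proof.
move=> [hN fN MN] [hp fp Mp]; split=> [a b ha hb|i n1 n2|//].
  have := hp _ _ (hN _ ha) (hN _ hb); congr (_ \in rho).
  by apply/ffunP=> i; rewrite !ffunE.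
by rewrite /= fN // fp.
Qed.

Definition xor_like p :=
  [/\ bop p, V false (p i1 (beta i1) (beta i1)) (p i2 b2 b2),
      V true (p i1 (beta i1) b1) (p i2 b2 (beta i2)),
      V true (p i1 b1 (beta i1)) (p i2 (beta i2) b2)
    & ~~ R0 (p i1 b1 b1) (beta i2)].

Lemma and_xor_like q : bop q -> computes q andb -> exists p, xor_like p.
Proof.
move=> hq cq; have [N hN cN] := negation_exists.
pose p i x y := q i (N i (q i x y)) (N i (q i (N i x) (N i y))).
have hp : bop p.
  exact: (bop_comp hq (bop_vcomp hN hq) (bop_vcomp hN (bop_compv hN hq))).
have cp : computes p addb.
  move=> c c' x y x' y' h h'.
  have -> : c (+) c' = ~~ (c && c') && ~~ (~~ c && ~~ c') by case: c c' {h h'} => -[].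
  by apply: (cq); apply: (cN); apply: (cq) => //; apply: (cN).
exists p; split=> //.
- exact: cp (V_can false) (V_can false).
- exact: cp (V_can false) (V_can true).
- exact: cp (V_can true) (V_can false).
- exact: V_false_true (cp _ _ _ _ _ _ (V_can true) (V_can true)) (V_can true).
Qed.

Lemma or_xor_like q : bop q -> computes q orb -> exists p, xor_like p.
Proof.
move=> hq cq; have [N hN cN] := negation_exists.
apply: (@and_xor_like (fun i x y => N i (q i (N i x) (N i y)))).
  exact: bop_vcomp hN (bop_compv hN hq).
move=> c c' x y x' y' h h'.
have -> : c && c' = ~~ (~~ c || ~~ c') by case: c c' {h h'} => -[].
by apply: (cN); apply: cq; apply: (cN).
Qed.

(** * Exclusive or from the WNU *)

Variables (m : nat) (f : tup A m -> A).
Hypothesis hf : is_WNU f.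
Hypothesis hfrho : op_preserves f rho.

Definition select (s : 'I_m -> option bool) i x y :=
  f [ffun l => match s l with Some true => x | Some false => y
                            | None => pt (beta i1) b2 i end].

Lemma select_bop s Psi : vop Psi -> bop (fun i x y => Psi i (select s i x y)).
Proof.
move=> [hPsi foff hM]; split=> [a b ha hb|i n1 n2|//].
  pose t l := match s l with Some true => a | Some false => b
                            | None => pt (beta i1) b2 end.
  have ht l : t l \in rho by rewrite /t; case: (s l) => [[]|] //.
  have := hPsi _ (hfrho ht); congr (_ \in rho); apply/ffunP=> i; rewrite !ffunE.
  congr (Psi i (f _)); apply/ffunP=> l; rewrite !ffunE /t.
  by case: (s l) => [[]|]; rewrite ?ffunE.
rewrite /select (_ : [ffun _ => _] = const_tup m (beta i)) ?hf.2.1 ?foff //.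
by apply/ffunP=> l; rewrite !ffunE (negbTE n1) (negbTE n2); case: (s l) => [[]|].
Qed.

(** Replace the arguments [e] of [f] by [u] one at a time, and let [j] be the first count at which
    the value leaves the class of [e]. *)
Lemma xor_like_exists : exists p, xor_like p.
Proof.
have [m2 [fid fwnu]] := hf.
pose Fx (S : 'I_m -> bool) := f [ffun l => cx (S l)].
pose Fy (S : 'I_m -> bool) := f [ffun l => cy (S l)].
have selE s c c' S : (forall l, (match s l with Some true => c | Some false => c'
      | None => false end) = S l) ->
    select s i1 (cx c) (cx c') = Fx S /\ select s i2 (cy c) (cy c') = Fy S.
  move=> hs; rewrite /select /Fx /Fy; split; congr (f _); apply/ffunP=> l; rewrite !ffunE -hs.
    by case: (s l) => [[]|]; rewrite // eqxx.
  by case: (s l) => [[]|]; rewrite // eqxx eq_sym (negbTE n12).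
have RF S : R0 (Fx S) (Fy S).
  have ht l : pt (cx (S l)) (cy (S l)) \in rho by case: (V_can (S l)).
  have := hfrho ht; rewrite /R0; congr (_ \in rho); apply/ffunP=> i; rewrite !ffunE.
  case: (i =P i1) => [->|/eqP n1].
    by congr (f _); apply/ffunP=> l; rewrite !ffunE eqxx.
  case: (i =P i2) => [->|/eqP n2].
    by congr (f _); apply/ffunP=> l; rewrite !ffunE eqxx eq_sym (negbTE n12).
  rewrite -[RHS]fid; congr (f _); apply/ffunP=> l.
  by rewrite !ffunE (negbTE n1) (negbTE n2).
pose below j (l : 'I_m) := l < j.
have F0 : Fx (below 0) = beta i1 /\ Fy (below 0) = b2.
  by split; rewrite -[RHS]fid; congr (f _); apply/ffunP=> l; rewrite !ffunE.
have Fm : Fx (below m) = b1.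
  by rewrite -[RHS]fid; congr (f _); apply/ffunP=> l; rewrite !ffunE /below ltn_ord.
(* By the WNU identities the position of a single [u] is irrelevant. *)
have Fsingle o : Fx (pred1 o) = Fx (below 1) /\ Fy (pred1 o) = Fy (below 1).
  pose o0 := Ordinal (ltnW m2).
  have sg (z z' : A) (o' : 'I_m) :
      f [ffun l => if l == o' then z else z'] = f (upd (const_tup m z') o' z).
    by congr (f _); apply/ffunP=> l; rewrite !ffunE.
  have bE : below 1 =1 pred1 o0 by move=> l; rewrite /below ltnS leqn0.
  rewrite /Fx /Fy; split.
    rewrite (_ : [ffun l => cx (below 1 l)] = [ffun l => if l == o0 then b1 else beta i1]).
      by rewrite sg -(fwnu _ _ o o0) -sg.
    by apply/ffunP=> l; rewrite !ffunE bE.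
  rewrite (_ : [ffun l => cy (below 1 l)] = [ffun l => if l == o0 then beta i2 else b2]).
    by rewrite sg -(fwnu _ _ o o0) -sg.
  by apply/ffunP=> l; rewrite !ffunE bE.
have nm : ~~ R0 (Fx (below m)) b2.
  by rewrite Fm; apply: contra R0_beta; apply: R0_rect.
have ex : exists j, ~~ R0 (Fx (below j)) b2 by exists m.
case: (ex_minnP ex) => j hj jmin.
have VF k : k < j -> V false (Fx (below k)) (Fy (below k)).
  move=> kj; have hk : R0 (Fx (below k)) b2.
    by apply: contraLR kj => /jmin; rewrite -leqNgt.
  by split=> //; apply: R0_rect R0b2 (RF _) hk.
have nF : ~~ R0 (beta i1) (Fy (below j)).
  by apply: contra hj => hj; apply: R0_rect (RF _) R0b2 hj.
have [Psi hPsi [h0 h1]] := separate R0b2 (RF _) nF.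
have PV := V_vapply (c := false) hPsi h0.
case: j => [|[|j]] in hj jmin VF nF h1 *.
- by rewrite F0.1 R0b2 in hj.
(* One [u] suffices: [f(x,y,e,...,e)] is a disjunction unless its value at [(u,u)] leaves the class
   of [u], and then it is already [xor_like]. *)
- pose s (l : 'I_m) := if l == 0 :> nat then Some true
                       else if l == 1 :> nat then Some false else None.
  have hq := select_bop s hPsi; set q := (fun i x y => _) in hq.
  have q00 : V false (q i1 (cx false) (cx false)) (q i2 (cy false) (cy false)).
    have [] := selE s false false (below 0); first by move=> l; rewrite /s; case: ifP => // _; case: ifP.
    by rewrite /q => -> ->; rewrite F0.1 F0.2.
  have q10 : V true (q i1 (cx true) (cx false)) (q i2 (cy true) (cy false)).
    have [] := selE s true false (below 1); last by rewrite /q => -> ->.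
    by move=> l; rewrite /s /below ltnS leqn0; case: ifP => // _; case: ifP.
  have q01 : V true (q i1 (cx false) (cx true)) (q i2 (cy false) (cy true)).
    have [] := selE s false true (pred1 (Ordinal m2)); last first.
      by rewrite /q => -> ->; have [-> ->] := Fsingle (Ordinal m2).
    move=> l; rewrite /s /= -val_eqE /=.
    by case: (val l) => [|[]].
  case: (boolP (R0 (q i1 b1 b1) (beta i2))) => q11; last by exists q; split.
  apply: (or_xor_like hq); apply: computes_can => // -[] [] //=.
  have q11' := R0_bapply hq R0b1 R0b1.
  by split=> //; apply: R0_rect R0b1 q11' q11.
(* The threshold is at least two. With [x] in all but one of the critical positions and [y] in the
   last, only [(u,u)] reaches it: a conjunction. *)
- pose s (l : 'I_m) := if l < j.+1 then Some true
                       else if l == j.+1 :> nat then Some false else None.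
  have hq := select_bop s hPsi; set q := (fun i x y => _) in hq.
  apply: (and_xor_like hq); apply: computes_can => // -[] [] /=.
  + have [] := selE s true true (below j.+2); last by rewrite /q => -> ->.
    by move=> l; rewrite /s /below [in RHS]ltnS [in RHS]leq_eqVlt; case: ltngtP.
  + have [] := selE s true false (below j.+1); last by rewrite /q => -> ->; apply/PV/VF.
    by move=> l; rewrite /s /below; case: ifP => // _; case: ifP.
  + have jm : j.+1 < m by apply: jmin.
    have [] := selE s false true (pred1 (Ordinal jm)); last first.
      by rewrite /q => -> ->; have [-> ->] := Fsingle (Ordinal jm); apply/PV/VF.
    move=> l; rewrite /s /= -val_eqE /=.
    by case: ltngtP.
  + have [] := selE s false false (below 0); first by move=> l; rewrite /s; case: ifP => // _; case: ifP.
    by rewrite /q => -> ->; rewrite F0.1 F0.2.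
Qed.

(** * Normalisation on the core *)

Lemma neutral_op_exists : exists p : 'I_n -> A -> A -> A,
  [/\ bpreserves p rho,
      forall i x y, x \in M i -> y \in M i -> p i x y \in M i,
      forall i x, x \in M i -> p i x (pt (beta i1) b2 i) = x,
      forall i x, x \in M i -> p i (pt (beta i1) b2 i) x = x
    & bapply p beta (pt b1 (beta i2)) \notin rho].
Proof.
have [p0 [hp0 p00 p01 p10 p11]] := xor_like_exists.
have [p0pres p0off p0M] := hp0.
set e := pt (beta i1) b2.
have e1 : e i1 = beta i1 by rewrite ffunE eqxx.
have e2 : e i2 = b2 by rewrite ffunE eqxx eq_sym (negbTE n12).
have eoff i : i != i1 -> i != i2 -> e i = beta i.
  by move=> n1 n2; rewrite ffunE (negbTE n1) (negbTE n2).
have eM i : e i \in M i.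
  by rewrite ffunE; case: eqP => [->|_]; [exact: beta_core | case: eqP => [->|_] //; exact: beta_core].
pose r i x := p0 i x (e i).
pose l i y := p0 i (e i) y.
have rpres : vpreserves r rho.
  by move=> a ha; have := p0pres _ _ ha R0b2; congr (_ \in rho); apply/ffunP=> i; rewrite !ffunE.
have lpres : vpreserves l rho.
  by move=> a ha; have := p0pres _ _ R0b2 ha; congr (_ \in rho); apply/ffunP=> i; rewrite !ffunE.
have roff : fix_off r by move=> i n1 n2; rewrite /r eoff // p0off.
have loff : fix_off l by move=> i n1 n2; rewrite /l eoff // p0off.
have rb : vapply r beta \notin rho.
  by rewrite -pt_beta vapply_pt // /r e1 e2; exact: V_false_true p00 p10.
have lb : vapply l beta \notin rho.
  by rewrite -pt_beta vapply_pt // /l e1 e2; exact: V_false_true p00 p01.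
have [r' [r'pres r'M rK r'K]] := core_inverse rpres rb (fun i x _ => p0M i x (e i)).
have [l' [l'pres l'M lK l'K]] := core_inverse lpres lb (fun i y _ => p0M i (e i) y).
(* [r'] makes [e] right neutral and the twist of [y] makes it left neutral; both are compatible
   since [r] and [l] agree at [e]. *)
pose p i x y := r' i (p0 i x (l' i (r i y))).
have rM i x : r i x \in M i by apply: p0M.
have pe i x : x \in M i -> p i x (e i) = x.
  by move=> hx; rewrite /p (_ : r i (e i) = l i (e i)) // lK // rK.
have ep i x : x \in M i -> p i (e i) x = x.
  by move=> hx; rewrite /p -/(l i _) l'K // rK.
exists p; split=> //; [|by move=> i x y hx hy; apply/r'M/p0M|].
  move=> a b ha hb.
  have := r'pres _ (p0pres _ _ ha (l'pres _ (rpres _ hb))); congr (_ \in rho).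
  by apply/ffunP=> i; rewrite !ffunE.
have poff : fix_off (fun i x => p i x x).
  by move=> i n1 n2; rewrite -{2}(eoff i) // pe // beta_core.
rewrite -{1}pt_beta bapply_pt // -{1}e1 ep //.
apply: contra p11 => h; have := R0_vapply rpres roff h.
rewrite {1}/r e1 /p r'K // => h'.
(* The images of [u] under [l] and [r] share the class of [u], so the twist [l' r] keeps [u] in its
   class; hence [p(u,u)] would contradict [p11]. *)
have [_ k1 _] := p10; have [_ k2 _] := p01; have [_ _ k3] := p10.
have k4 := R0_rect k2 k3 R0b1.
have l'off : fix_off l' by move=> i n1 n2; rewrite -{1}(loff i) // lK ?beta_core.
have := R0_vapply l'pres l'off k4.
rewrite -{1}e1 lK // -{1}e2 => k5.
exact: R0_rect (R0_bapply hp0 R0b1 k5) k1 h'.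
Qed.

(** [p(-, u)] keeps [beta] outside [rho], so it is invertible on the core; at [i2] the value of [u]
    is that of [beta], whence the last clause. *)
Lemma shift_op_exists : exists p, shift_op p i1 i2 b1 b2.
Proof.
have [p [ppres pM pe ep pb]] := neutral_op_exists.
have eE : pt (beta i1) b2 = upd beta i2 b2.
  apply/ffunP=> i; rewrite !ffunE; case: (i =P i1) => [->|_] //.
  by rewrite (negbTE n12).
have uE : pt b1 (beta i2) = upd beta i1 b1.
  apply/ffunP=> i; rewrite !ffunE; case: (i =P i1) => // _.
  by case: eqP => // ->.
rewrite eE in pe ep; rewrite uE in pb.
set u := upd beta i1 b1 in pb *.
have uR : u \in rho by rewrite /u -uE.
have uM i : u i \in M i.
  by rewrite ffunE; case: eqP => [->|_] //; apply: beta_core.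
have u2 : u i2 = beta i2 by rewrite ffunE eq_sym (negbTE n12).
pose T i x := p i x (u i).
have TE a : vapply T a = bapply p a u by apply/ffunP=> i; rewrite !ffunE.
have Tpres : vpreserves T rho by move=> a ha; rewrite TE; apply: ppres.
have Tb : vapply T beta \notin rho by rewrite TE.
have [T' [T'pres _ TK _]] := core_inverse Tpres Tb (fun i x hx => pM i x _ hx (uM i)).
exists p; split=> // [i x hx|a aM|y y' hy hy' eq_yy']; first by split; [apply: pe | apply: ep].
  rewrite -TE => /T'pres; congr (_ \in rho).
  by apply/ffunP=> i; rewrite !ffunE TK.
by rewrite -(TK i2 y) // -(TK i2 y') // /T u2 eq_yy'.
Qed.

End Rectangle.
End Core.

(** * The pattern as rectangularity *)

Lemma pattern_rect (A : finType) n (rho : relA A n) (i j : 'I_n) (a : tup A n) bi bj :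
  i != j -> pattern rho i j -> upd a i bi \in rho -> upd a j bj \in rho ->
  upd (upd a i bi) j bj \in rho -> a \in rho.
Proof.
move=> /eqP nij [//|npat] hi hj hij; case: (boolP (a \in rho)) => // na.
by case: npat; exists a, bi, bj.
Qed.

Lemma pattern_sym (A : finType) n (rho : relA A n) (i j : 'I_n) :
  pattern rho i j -> pattern rho j i.
Proof.
case: (i =P j) => [->|/eqP nij pij]; first by left.
right=> -[a [bj [bi [na [hj [hi hji]]]]]]; case/negP: na.
by apply: (pattern_rect nij pij hi hj); rewrite updC.
Qed.

(** A decidable equality or a negation is stable, so arguing by contradiction stays constructive. *)
Lemma pattern_stable (A : finType) n (rho : relA A n) i j :
  ~ ~ pattern rho i j -> pattern rho i j.
Proof.
case: (i =P j) => [->|nij nnp]; first by left.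
by right=> ex; apply: nnp => -[].
Qed.

(** * Transitivity and the single nontrivial class *)

Section Pattern.
Variables (A : finType) (n : nat) (rho : relA A n) (beta : tup A n).
Hypothesis hess : essential rho.
Hypothesis hkey : key_tuple rho beta.
Variables (m : nat) (f : tup A m -> A).
Hypothesis hf : is_WNU f.
Hypothesis hfrho : op_preserves f rho.
Variables (E : 'I_n -> A -> A) (M : 'I_n -> {set A}).
Hypothesis hE : vpreserves E rho.
Hypothesis hEb : vapply E beta = beta.
Hypothesis hEM : forall i x, E i x \in M i.
Hypothesis core_inj : forall Psi, vpreserves Psi rho -> vapply Psi beta \notin rho ->
        forall i, {in M i &, injective (Psi i)}.

Lemma core_flip i : exists2 b, b \in M i & upd beta i b \in rho.
Proof.
have [b hb] := essential_key_tuple hkey i hess.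
by exists (E i b) => //; have := hE hb; rewrite vapply_upd hEb.
Qed.

Lemma core_not_pattern i j : ~ pattern rho i j ->
  exists bi bj, [/\ bi \in M i, bj \in M j, upd beta i bi \in rho, upd beta j bj \in rho
                  & upd (upd beta i bi) j bj \in rho].
Proof.
move=> /(not_pattern_key_tuple hkey) [bi [bj [/hE hi /hE hj /hE hij]]].
by exists (E i bi), (E j bj); rewrite !vapply_upd hEb in hi hj hij.
Qed.

Lemma pattern_shift i1 i2 b1 b2 : i1 != i2 -> pattern rho i1 i2 ->
  b1 \in M i1 -> b2 \in M i2 -> upd beta i1 b1 \in rho -> upd beta i2 b2 \in rho ->
  exists p, shift_op rho beta M p i1 i2 b1 b2.
Proof.
move=> n12 p12 b1M b2M hb1 hb2.
have ptE x y : pt beta i1 i2 x y = upd (upd beta i1 x) i2 y.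
  apply/ffunP=> i; rewrite !ffunE; case: (i =P i1) => [->|_] //.
  by rewrite (negbTE n12).
apply: (shift_op_exists hkey hE hEb hEM core_inj n12 _ b1M b2M _ _ hf hfrho).
- move=> x x' y y'; rewrite /R0 !ptE => h1 h2 h3.
  have n21 : i2 != i1 by rewrite eq_sym.
  apply: (@pattern_rect _ _ _ i1 i2 _ x' y' n12 p12); last 1 first.
  + by rewrite (updC _ _ _ n21) !upd_upd.
  + by rewrite (updC _ _ _ n21) upd_upd.
  + by rewrite upd_upd.
- by rewrite /R0 ptE updC // upd_id.
- by rewrite /R0 ptE upd_id.
Qed.

Lemma pattern_trans_neq i1 i2 i3 : i1 != i2 -> i2 != i3 -> i1 != i3 ->
  pattern rho i1 i2 -> pattern rho i2 i3 -> pattern rho i1 i3.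
Proof.
move=> n12 n23 n13 p12 p23; apply: pattern_stable => /core_not_pattern [b1 [b3 [b1M b3M hb1 hb3 hb13]]].
have [b2 b2M hb2] := core_flip i2.
have [p [ppres pM pe pcan pinj]] := pattern_shift n12 p12 b1M b2M hb1 hb2.
have betaM i : beta i \in M i by apply: beta_core hEb hEM i.
have pb i x : i != i2 -> x \in M i -> p i x (beta i) = x /\ p i (beta i) x = x.
  by move=> ni /pe; rewrite ffunE (negbTE ni).
have pbb i : i != i2 -> p i (beta i) (beta i) = beta i.
  by move=> ni; have [] := pb i (beta i) ni (betaM i).
have n32 : i3 != i2 by rewrite eq_sym.
have n31 : i3 != i1 by rewrite eq_sym.
pose c3 := p i3 b3 b3.
have c3M : c3 \in M i3 by apply: pM.
have hc3 : upd beta i3 c3 \in rho.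
  apply: pcan => [i|]; first by rewrite ffunE; case: eqP => [->|].
  have := ppres _ _ hb3 hb13; congr (_ \in rho); apply/ffunP=> i; rewrite !ffunE.
  case: (i =P i3) => [->|_] //; rewrite (negbTE n31).
  by have [] := pb i3 c3 n32 c3M.
pose Y := [set y in M i2 | upd (upd beta i2 y) i3 b3 \in rho].
pose T y := p i2 y (beta i2).
have YM y : y \in Y -> y \in M i2 by rewrite inE => /andP[].
have TY : T @: Y \subset Y.
  apply/subsetP=> _ /imsetP[y /[!inE] /andP[yM hy] ->].
  rewrite pM //=.
  (* The three known corners at [(i2, i3)] are [(beta i2, b3)], [(T y, c3)] and [(beta i2, c3)]. *)
  apply: (@pattern_rect _ _ _ i2 i3 _ (beta i2) c3 n23 p23).
  - by rewrite (updC _ _ _ n32) upd_upd upd_id.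
  - have := ppres _ _ hy hb3; congr (_ \in rho); apply/ffunP=> i; rewrite !ffunE.
    case: (i =P i3) => [->|_] //.
    by case: (i =P i2) => [->|/eqP ni2] //; rewrite pbb.
  - by rewrite (updC _ _ _ n32) !upd_upd upd_id.
have /eqP TYE : T @: Y == Y.
  have Tinj : {in Y &, injective T} by move=> y y' /YM hy /YM; apply: pinj.
  by rewrite eqEcard TY (card_in_imset Tinj) /=.
(* [T] permutes [Y], so [beta i2] has a preimage in [Y]; it is [b2], since [b2] is left neutral at
   [i2]. *)
have : beta i2 \in T @: Y by rewrite TYE inE betaM upd_id.
case/imsetP=> y yY eqy.
have ey : y = b2.
  apply: pinj => //; first exact: YM.
  by rewrite -/(T y) -eqy; have [_] := pe i2 (beta i2) (betaM i2); rewrite ffunE eqxx => ->.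
move: yY; rewrite inE ey => /andP[_ hb23].
by have := key_tuple_notin hkey; rewrite (pattern_rect n23 p23 hb2 hb3).
Qed.

Lemma pattern_of_nontrivial_pairs i1 i2 i3 i4 :
  i1 != i2 -> i3 != i4 -> i3 != i1 -> i3 != i2 -> i4 != i1 -> i4 != i2 ->
  pattern rho i1 i2 -> pattern rho i3 i4 -> pattern rho i1 i4.
Proof.
move=> n12 n34 n31 n32 n41 n42 p12 p34.
apply: pattern_stable => /core_not_pattern [b1 [b4 [b1M b4M hb1 hb4 hb14]]].
have [b2 b2M hb2] := core_flip i2; have [b3 b3M hb3] := core_flip i3.
have [p [ppres pM pe pcan _]] := pattern_shift n12 p12 b1M b2M hb1 hb2.
have betaM i : beta i \in M i by apply: beta_core hEb hEM i.
have pb i x : i != i2 -> x \in M i -> p i x (beta i) = x /\ p i (beta i) x = x.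
  by move=> ni /pe; rewrite ffunE (negbTE ni).
have n43 : i4 != i3 by rewrite eq_sym.
have hb34 : upd (upd beta i3 b3) i4 b4 \in rho.
  apply: pcan => [i|].
    by rewrite !ffunE; case: eqP => [->|_] //; case: eqP => [->|].
  have := ppres _ _ hb3 hb14; congr (_ \in rho); apply/ffunP=> i; rewrite !ffunE.
  case: (i =P i4) => [->|_] //; rewrite (negbTE n43) (negbTE n41).
  by have [-> ->] := pb i4 b4 n42 b4M.
by have := key_tuple_notin hkey; rewrite (pattern_rect n34 p34 hb3 hb4).
Qed.

End Pattern.

Theorem mainTheorem3 (A : finType) (n : nat) (rho : {set {ffun 'I_n -> A}})
  (hn : (3 <= n)%N)
  (hess : essential rho) (hkey : key_relation rho)
  (hwnu : exists (m : nat) (f : {ffun 'I_m -> A} -> A),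
            is_WNU f /\ op_preserves f rho) :
  ((forall i, pattern rho i i) /\
   (forall i j, pattern rho i j -> pattern rho j i) /\
   (forall i j k, pattern rho i j -> pattern rho j k -> pattern rho i k)) /\
  (forall i j k l : 'I_n, i <> j -> pattern rho i j ->
     k <> l -> pattern rho k l -> pattern rho i k).
Proof.
have [beta hb] := hkey; have [m [f [hf hfrho]]] := hwnu.
have [E [M [hE hEb hEM Minj]]] := core_exists hb.
have trans i j k : pattern rho i j -> pattern rho j k -> pattern rho i k.
  case: (i =P j) => [->|/eqP nij] //; case: (j =P k) => [->|/eqP njk] //.
  case: (i =P k) => [->|/eqP nik pij pjk]; first by left.
  exact: (pattern_trans_neq hess hb hf hfrho hE hEb hEM Minj nij njk nik).
split; first by split; [left | split; [exact: pattern_sym | exact: trans]].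
move=> i j k l /eqP nij pij /eqP nkl pkl.
(* Pairs sharing an element are settled by symmetry and transitivity. For disjoint pairs, the second
   is reversed so that [k] ends up related to [i]. *)
case: (k =P i) => [->|/eqP nki]; first by left.
case: (k =P j) => [->|/eqP nkj] //.
case: (l =P i) => [eli|/eqP nli]; first by apply: pattern_sym; rewrite -eli.
case: (l =P j) => [elj|/eqP nlj].
  by apply: trans pij _; rewrite -elj; apply: pattern_sym.
have nlk : l != k by rewrite eq_sym.
apply: (pattern_of_nontrivial_pairs hess hb hf hfrho hE hEb hEM Minj nij nlk) => //.
exact: pattern_sym.
Qed.
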